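(* Let $E$ be a Banach lattice. The following assertions are equivalent: (1) $E$ has the disjoint weak Banach-Saks property. (2) Every disjoint weakly null sequence $(x_n)\subset E^+$ has a subsequence whose Cesàro sequence is norm convergent.
   Context: A sequence $(x_n)$ in a Banach lattice is disjoint if $|x_n|\wedge|x_m|=0$ for $n\ne m$. The Cesàro sequence of $(y_k)$ is $\left(\frac1m\sum_{k=1}^m y_k\right)_m$. A Banach lattice $E$ has the disjoint weak Banach-Saks property if every disjoint weakly null sequence in $E$ has a subsequence whose Cesàro sequence is norm convergent in $E$. *)

(* Defs.v *)
From HB Require Import structures.
From mathcomp Require Import all_boot all_order all_algebra.
From mathcomp Require Import all_classical all_reals all_analysis.

Set Implicit Arguments.
Unset Strict Implicit.
Unset Printing Implicit Defensive.

Import Order.TTheory GRing.Theory Num.Theory.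
Import numFieldNormedType.Exports.

Local Open Scope classical_set_scope.
Local Open Scope ring_scope.

(* Hierarchy-Builder rejects the join of MathComp's Order.Lattice with modules
   and normed modules: the intermediate joins below the number domains are
   missing. Hence a vector lattice carries its order and its binary suprema and
   infima as operations of its own. *)
HB.mixin Record Lmodule_isRiesz (R : realType) E & GRing.Lmodule R E := {
  riesz_le : rel E ;
  riesz_join : E -> E -> E ;
  riesz_meet : E -> E -> E ;
  riesz_le_refl : reflexive riesz_le ;
  riesz_le_anti : antisymmetric riesz_le ;
  riesz_le_trans : transitive riesz_le ;
  riesz_leUx : forall x y z : E,
    riesz_le (riesz_join x y) z = riesz_le x z && riesz_le y z ;
  riesz_lexI : forall x y z : E,
    riesz_le z (riesz_meet x y) = riesz_le z x && riesz_le z y ;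
  riesz_leD2r : forall z x y : E, riesz_le x y -> riesz_le (x + z) (y + z) ;
  riesz_scale_ge0 : forall (a : R) (x : E),
    0 <= a -> riesz_le 0 x -> riesz_le 0 (a *: x)
}.

#[short(type="rieszType")]
HB.structure Definition Riesz (R : realType) :=
  { E of GRing.Lmodule R E & Lmodule_isRiesz R E }.

(* The lattice modulus |x| : E, not to be confused with the norm `|x| : R. *)
Definition modulus (R : realType) (E : rieszType R) (x : E) : E :=
  riesz_join x (- x).

HB.mixin Record Riesz_CompleteNormedModule_isBanachLattice (R : realType) E
    & Riesz R E & CompleteNormedModule R E := {
  ler_norm_modulus : forall x y : E,
    riesz_le (modulus x) (modulus y) -> `|x| <= `|y|
}.

#[short(type="banachLatticeType")]
HB.structure Definition BanachLattice (R : realType) :=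
  { E of Riesz R E & CompleteNormedModule R E
       & Riesz_CompleteNormedModule_isBanachLattice R E }.

Definition disjoint_seq (R : realType)
    (E : rieszType R) (x : nat -> E) : Prop :=
  forall n m : nat, n <> m -> riesz_meet (modulus (x n)) (modulus (x m)) = 0.

Definition weakly_null (R : realType) (E : normedModType R)
    (x : nat -> E) : Prop :=
  forall f : {linear E -> R^o}, continuous f -> f (x n) @[n --> \oo] --> (0 : R^o).

(* Sequences are indexed from 0: the term of index m is the mean of the first
   m + 1 terms of y. *)
Definition cesaro_seq (R : realType) (E : normedModType R)
    (y : nat -> E) : nat -> E :=
  fun m => m.+1%:R^-1 *: series y m.+1.

Definition has_cesaro_cvg_subseq (R : realType) (E : normedModType R)
    (x : nat -> E) : Prop :=
  exists2 phi : nat -> nat, increasing_seq phi & cvgn (cesaro_seq (x \o phi)).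

Definition disjoint_weak_Banach_Saks (R : realType)
    (E : banachLatticeType R) : Prop :=
  forall x : nat -> E,
    disjoint_seq x -> weakly_null x -> has_cesaro_cvg_subseq x.

(* Main.v *)
From HB Require Import structures.
Require Import Defs.
From mathcomp Require Import all_boot all_order all_algebra.
From mathcomp Require Import all_classical all_reals all_analysis.
From mathcomp Require Import ring.

Import Order.TTheory GRing.Theory Num.Theory.
Import numFieldNormedType.Exports.

Local Open Scope classical_set_scope.
Local Open Scope ring_scope.

(** Only one implication needs an argument, since the other one restricts the
    property to positive sequences. Treating the positive and the negative parts
    of (x_n) separately does not suffice, because Cesàro convergence does not
    pass to subsequences. The moduli |x_n| are used instead, which takes two
    facts.

    First, if (x_n) is disjoint and weakly null, so is (|x_n|)
    ([disjoint_weakly_null_modulus]). Let f be a continuous functional and B the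
    set of all negative parts x_n^-. On the positive cone put
      p(y) = sup { f(z) : 0 <= z <= y, z disjoint from B }.
    The Riesz decomposition property makes p additive ([disjoint_supD]), so p
    extends to a continuous linear functional g ([disjoint_ext_continuous]).
    Each x_n^+ is disjoint from B, so p(x_n^+) >= f(x_n^+), while p(x_n^-) = 0,
    whence f(x_n^+) <= g(x_n) -> 0. The same bound for -f gives
    f(x_n^+) -> 0, and exchanging x_n and -x_n gives f(x_n^-) -> 0.

    Second, if the Cesàro means s_n of a positive disjoint sequence converge in
    norm, their limit is 0 ([cesaro_disjoint_cvg0]): the mean of the first n
    terms satisfies s_n - s_{2n} = (u - v) / 2n, where u = n s_n is disjoint
    from the sum v of the next n terms, hence s_n / 2 <= |s_n - s_{2n}|, and the
    right-hand side tends to 0 in norm.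

    By assumption the moduli have a subsequence with convergent Cesàro means;
    these tend to 0 in norm and dominate the moduli of the means of the
    corresponding subsequence of (x_n). *)

Local Notation "x <=E y" := (riesz_le x y) (at level 70, no associativity).

(** * Vector lattices *)

Section VectorLattice.
Context {R : realType} {E : rieszType R}.
Implicit Types (x y z : E) (a : R).

Lemma riesz_leD2rE z x y : (x + z <=E y + z) = (x <=E y).
Proof.
by apply/idP/idP => [/(riesz_leD2r (- z))|/riesz_leD2r//]; rewrite !addrK.
Qed.

Lemma riesz_le_subr x y z : (x <=E y - z) = (x + z <=E y).
Proof. by rewrite -(riesz_leD2rE z) subrK. Qed.

Lemma riesz_le_subl x y z : (x - z <=E y) = (x <=E y + z).
Proof. by rewrite -(riesz_leD2rE z) subrK. Qed.

Lemma riesz_subr_ge0 x y : (0 <=E y - x) = (x <=E y).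
Proof. by rewrite riesz_le_subr add0r. Qed.

Lemma riesz_leN2 x y : (- x <=E - y) = (y <=E x).
Proof. by rewrite -riesz_subr_ge0 opprK addrC riesz_subr_ge0. Qed.

Lemma riesz_leD x y z t : x <=E y -> z <=E t -> x + z <=E y + t.
Proof.
move=> xy zt; apply: (riesz_le_trans (y + z)); first by rewrite riesz_leD2rE.
by rewrite ![y + _]addrC riesz_leD2rE.
Qed.

Lemma riesz_addr_ge0 x y : 0 <=E x -> 0 <=E y -> 0 <=E x + y.
Proof. by move=> x0 y0; rewrite -[X in X <=E _](addr0 0) riesz_leD. Qed.

Lemma riesz_sum_ge0 (x : nat -> E) m n :
  (forall k, 0 <=E x k) -> 0 <=E \sum_(m <= k < n) x k.
Proof.
move=> x0; elim/big_ind : _ => //; first exact: riesz_le_refl.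
exact: riesz_addr_ge0.
Qed.

Lemma riesz_le_scale a x y : 0 <= a -> x <=E y -> a *: x <=E a *: y.
Proof.
by move=> a0 xy; rewrite -riesz_subr_ge0 -scalerBr riesz_scale_ge0 ?riesz_subr_ge0.
Qed.

Lemma riesz_le_scalel a x y : 0 < a -> (a *: x <=E y) = (x <=E a^-1 *: y).
Proof.
move=> a0; have a'0 : a != 0 by rewrite gt_eqF.
apply/idP/idP => [/(riesz_le_scale a^-1)|/(riesz_le_scale a)].
  by rewrite scalerA mulVf// scale1r; apply; rewrite invr_ge0 ltW.
by rewrite scalerA mulfV// scale1r; apply; exact: ltW.
Qed.

Lemma riesz_eq_ub x y : (forall z, (x <=E z) = (y <=E z)) -> x = y.
Proof. by move=> H; apply: riesz_le_anti; rewrite H riesz_le_refl -H riesz_le_refl. Qed.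

Lemma riesz_eq_lb x y : (forall z, (z <=E x) = (z <=E y)) -> x = y.
Proof. by move=> H; apply: riesz_le_anti; rewrite -H riesz_le_refl H riesz_le_refl. Qed.

Lemma riesz_joinC x y : riesz_join x y = riesz_join y x.
Proof. by apply: riesz_eq_ub => z; rewrite !riesz_leUx andbC. Qed.

Lemma riesz_meetC x y : riesz_meet x y = riesz_meet y x.
Proof. by apply: riesz_eq_lb => z; rewrite !riesz_lexI andbC. Qed.

Lemma riesz_joinl x y : x <=E riesz_join x y.
Proof. by have := riesz_le_refl (riesz_join x y); rewrite riesz_leUx => /andP[]. Qed.

Lemma riesz_joinr x y : y <=E riesz_join x y.
Proof. by rewrite riesz_joinC riesz_joinl. Qed.

Lemma riesz_meetl x y : riesz_meet x y <=E x.
Proof. by have := riesz_le_refl (riesz_meet x y); rewrite riesz_lexI => /andP[]. Qed.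

Lemma riesz_meetr x y : riesz_meet x y <=E y.
Proof. by rewrite riesz_meetC riesz_meetl. Qed.

Lemma riesz_joinD x y z : riesz_join x y + z = riesz_join (x + z) (y + z).
Proof.
by apply: riesz_eq_ub => w; rewrite riesz_leUx -!riesz_le_subr riesz_leUx.
Qed.

Lemma riesz_meetE x y : riesz_meet x y = - riesz_join (- x) (- y).
Proof.
apply: riesz_eq_lb => z.
by rewrite riesz_lexI -[z]opprK riesz_leN2 riesz_leUx !riesz_leN2 opprK.
Qed.

Lemma riesz_joinZ a x y : 0 < a ->
  a *: riesz_join x y = riesz_join (a *: x) (a *: y).
Proof.
move=> a0; apply: riesz_eq_ub => w.
by rewrite riesz_leUx !riesz_le_scalel// riesz_leUx.
Qed.

(** The positive part x^+; the negative part of x is the positive part of -x. *)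
Definition pos_part x : E := riesz_join x 0.

Lemma pos_part_ge0 x : 0 <=E pos_part x. Proof. exact: riesz_joinr. Qed.

Lemma pos_part_id x : 0 <=E x -> pos_part x = x.
Proof.
by move=> x0; apply: riesz_eq_ub => z; rewrite riesz_leUx; apply: andb_idr;
  exact: riesz_le_trans.
Qed.

Lemma pos_partB x : pos_part x - pos_part (- x) = x.
Proof.
apply/eqP; rewrite subr_eq addrC; apply/eqP.
by rewrite /pos_part riesz_joinD addNr add0r riesz_joinC.
Qed.

Lemma pos_part_subE x y : pos_part (x - y) = x - riesz_meet x y.
Proof.
by rewrite riesz_meetE opprK [RHS]addrC riesz_joinD addNr riesz_joinC
  [- y + x]addrC.
Qed.

Lemma pos_part_disjoint x : riesz_meet (pos_part x) (pos_part (- x)) = 0.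
Proof.
have := pos_part_subE (pos_part x) (pos_part (- x)).
by rewrite pos_partB => /eqP; rewrite eq_sym subr_eq addrC -subr_eq subrr => /eqP.
Qed.

Lemma pos_partZ a x : 0 <= a -> pos_part (a *: x) = a *: pos_part x.
Proof.
rewrite le_eqVlt => /predU1P[<-|a0].
  by rewrite !scale0r pos_part_id// riesz_le_refl.
by rewrite /pos_part riesz_joinZ// scaler0.
Qed.

Lemma modulusE x : modulus x = pos_part x + pos_part (- x).
Proof.
have -> : pos_part (- x) = pos_part x - x.
  by rewrite /pos_part riesz_joinD subrr add0r riesz_joinC.
apply/eqP; rewrite addrA eq_sym subr_eq; apply/eqP.
rewrite /modulus [RHS]riesz_joinD addNr.
have := pos_partZ 2 x (ler0n _ _).
by rewrite ![2 *: _]scaler_nat !mulr2n.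
Qed.

Lemma modulusN x : modulus (- x) = modulus x.
Proof. by rewrite /modulus opprK riesz_joinC. Qed.

Lemma modulus_ge0 x : 0 <=E modulus x.
Proof. by rewrite modulusE riesz_addr_ge0 ?pos_part_ge0. Qed.

Lemma modulus_id x : 0 <=E x -> modulus x = x.
Proof.
move=> x0; apply: riesz_eq_ub => z; rewrite riesz_leUx; apply: andb_idr => xz.
apply: riesz_le_trans (riesz_le_trans _ _ _ x0 xz).
by rewrite -[0]oppr0 riesz_leN2.
Qed.

Lemma pos_part_le_modulus x : pos_part x <=E modulus x.
Proof. by rewrite riesz_leUx riesz_joinl modulus_ge0. Qed.

Lemma modulus_sum_le (x : nat -> E) m n :
  modulus (\sum_(m <= k < n) x k) <=E \sum_(m <= k < n) modulus (x k).
Proof.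
rewrite riesz_leUx -sumrN; apply/andP; split;
  elim/big_ind2 : _ => [|*|k _];
  by [exact: riesz_le_refl|exact: riesz_leD|exact: riesz_joinl|exact: riesz_joinr].
Qed.

Lemma modulusZ a x : 0 <= a -> modulus (a *: x) = a *: modulus x.
Proof. by move=> a0; rewrite !modulusE -scalerN !pos_partZ// scalerDr. Qed.

(** The Riesz decomposition property. *)
Lemma riesz_decomposition z x y : 0 <=E z -> 0 <=E x -> 0 <=E y -> z <=E x + y ->
  exists2 z1, 0 <=E z1 /\ z1 <=E x & 0 <=E z - z1 /\ z - z1 <=E y.
Proof.
move=> z0 x0 y0 zxy; exists (riesz_meet z x).
  by rewrite riesz_lexI z0 x0 riesz_meetr.
rewrite riesz_subr_ge0 riesz_meetl -pos_part_subE riesz_leUx y0 andbT.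
by rewrite riesz_le_subl addrC.
Qed.

Lemma riesz_meet_ge0_eq0 x y : 0 <=E x -> 0 <=E y ->
  (forall z, z <=E x -> z <=E y -> z <=E 0) -> riesz_meet x y = 0.
Proof.
move=> x0 y0 H; apply: riesz_le_anti.
by rewrite H ?riesz_meetl ?riesz_meetr// riesz_lexI x0 y0.
Qed.

Lemma riesz_meet_eq0_le x y z : riesz_meet x y = 0 ->
  z <=E x -> z <=E y -> z <=E 0.
Proof. by move=> xy0 zx zy; rewrite -xy0 riesz_lexI zx zy. Qed.

Lemma riesz_meet_eq0_mono x x' y y' : 0 <=E x' -> 0 <=E y' ->
  x' <=E x -> y' <=E y -> riesz_meet x y = 0 -> riesz_meet x' y' = 0.
Proof.
move=> x'0 y'0 x'x y'y xy0; apply: riesz_meet_ge0_eq0 => // z zx zy.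
by apply: (riesz_meet_eq0_le _ _ _ xy0); [exact: riesz_le_trans x'x|
  exact: riesz_le_trans y'y].
Qed.

Lemma riesz_meetD_eq0 x y z : 0 <=E x -> 0 <=E y -> 0 <=E z ->
  riesz_meet x z = 0 -> riesz_meet y z = 0 -> riesz_meet (x + y) z = 0.
Proof.
move=> x0 y0 z0 xz yz; apply: riesz_meet_ge0_eq0 => //.
  exact: riesz_addr_ge0.
move=> w wxy wz; apply: (riesz_meet_eq0_le _ _ _ xz) => //.
rewrite -[x]add0r -riesz_le_subl; apply: (riesz_meet_eq0_le _ _ _ yz).
  by rewrite riesz_le_subl addrC.
by rewrite riesz_le_subl -[w]addr0 riesz_leD.
Qed.

Lemma riesz_meetZ_eq0 a x y : 0 <= a -> 0 <=E x -> 0 <=E y ->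
  riesz_meet x y = 0 -> riesz_meet (a *: x) y = 0.
Proof.
move=> a0 x0 y0 xy; apply: riesz_meet_ge0_eq0 => //.
  exact: riesz_scale_ge0.
move=> z zx zy.
(* both x and y are scaled by the factor 1 + a, which is at least a and at least 1 *)
have a1 : 0 < 1 + a by rewrite ltr_wpDr.
have : (1 + a)^-1 *: z <=E 0.
  apply: (riesz_meet_eq0_le _ _ _ xy);
    rewrite riesz_le_scalel ?invr_gt0// invrK scalerDl scale1r.
    by rewrite -[z]add0r riesz_leD.
  by rewrite -[z]addr0 riesz_leD// riesz_scale_ge0.
by rewrite riesz_le_scalel ?invr_gt0// invrK scaler0.
Qed.

Lemma riesz_meet_sum_eq0 (x : nat -> E) y m n :
  (forall k, 0 <=E x k) -> 0 <=E y ->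
  (forall k, (m <= k < n)%N -> riesz_meet (x k) y = 0) ->
  riesz_meet (\sum_(m <= k < n) x k) y = 0.
Proof.
move=> x0 y0 xy; rewrite big_nat.
suff [] : riesz_meet (\sum_(m <= i < n | (m <= i < n)%N) x i) y = 0 /\
  0 <=E \sum_(m <= i < n | (m <= i < n)%N) x i by [].
elim/big_ind : _ => [|u v [uy u0] [vy v0]|k /xy//].
  split; last exact: riesz_le_refl.
  by apply: riesz_meet_ge0_eq0 => //; exact: riesz_le_refl.
by split; [exact: riesz_meetD_eq0|exact: riesz_addr_ge0].
Qed.

End VectorLattice.

(** * Functionals concentrated on a disjoint complement *)

Section DisjointComplement.
Context {R : realType} {E : banachLatticeType R}.
Implicit Types (x y z : E) (B : set E).

Lemma ler_norm_riesz x y : 0 <=E x -> x <=E y -> `|x| <= `|y|.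
Proof.
move=> x0 xy; apply: ler_norm_modulus; rewrite !modulus_id//.
exact: riesz_le_trans xy.
Qed.

Lemma norm_modulus x : `|modulus x| = `|x|.
Proof.
have idm := modulus_id _ (modulus_ge0 x).
by apply/eqP; rewrite eq_le !ler_norm_modulus// idm riesz_le_refl.
Qed.

Lemma norm_pos_part x : `|pos_part x| <= `|x|.
Proof.
by rewrite -(norm_modulus x) ler_norm_riesz ?pos_part_ge0 ?pos_part_le_modulus.
Qed.

(** The elements of the order interval [0, y] disjoint from the members of B. *)
Definition disjoint_below B y : set E :=
  [set z | [/\ 0 <=E z, z <=E y & forall w, B w -> riesz_meet z w = 0]].

(** When y is positive and has a component Py in the disjoint complement of B,
    this is the value at Py of the positive part of f. The supremum makes sense
    whether or not such a component exists, as soon as f is bounded. *)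
Definition disjoint_sup (f : E -> R) B y : R := sup (f @` disjoint_below B y).

Section Construction.
Variables (f : {linear E -> R^o}) (B : set E) (M : R).
Hypothesis M0 : 0 <= M.
Hypothesis fM : forall x, `|f x| <= M * `|x|.
Hypothesis B0 : forall w, B w -> 0 <=E w.

Local Notation p := (disjoint_sup f B).

Lemma disjoint_below0 y : 0 <=E y -> disjoint_below B y 0.
Proof.
move=> y0; split=> [|//|w /B0 w0]; first exact: riesz_le_refl.
by apply: riesz_meet_ge0_eq0 => //; exact: riesz_le_refl.
Qed.

Lemma disjoint_below_bound y z : disjoint_below B y z -> f z <= M * `|y|.
Proof.
move=> [z0 zy _]; apply: le_trans (ler_norm _) _; apply: le_trans (fM _) _.
by rewrite ler_wpM2l// ler_norm_riesz.
Qed.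

Lemma disjoint_sup_ub y z : disjoint_below B y z -> f z <= p y.
Proof.
move=> yz; apply: ub_le_sup; last by exists z.
by exists (M * `|y|) => _ [u yu <-]; exact: disjoint_below_bound.
Qed.

Lemma disjoint_sup_le y c : 0 <=E y ->
  (forall z, disjoint_below B y z -> f z <= c) -> p y <= c.
Proof.
move=> y0 yc; apply: ge_sup; last by move=> _ [z yz <-]; exact: yc.
by exists (f 0), 0 => //; exact: disjoint_below0.
Qed.

Lemma disjoint_sup_ge0 y : 0 <=E y -> 0 <= p y.
Proof.
by move=> y0; rewrite -(linear0 f) disjoint_sup_ub//; exact: disjoint_below0.
Qed.

Lemma disjoint_sup_bound y : 0 <=E y -> p y <= M * `|y|.
Proof. by move=> y0; apply: disjoint_sup_le => // z /disjoint_below_bound. Qed.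

Lemma disjoint_supD x y : 0 <=E x -> 0 <=E y -> p (x + y) = p x + p y.
Proof.
move=> x0 y0; apply/eqP; rewrite eq_le; apply/andP; split.
  apply: disjoint_sup_le => [|z [z0 zxy zB]]; first exact: riesz_addr_ge0.
  have [z1 [z10 z1x] [z20 z2y]] := riesz_decomposition _ _ _ z0 x0 y0 zxy.
  rewrite -[z](subrKC z1) linearD lerD// disjoint_sup_ub//; split=> // w Bw;
    apply: riesz_meet_eq0_mono (zB w Bw) => //;
    rewrite ?riesz_le_refl ?B0//.
    by rewrite -riesz_subr_ge0.
  by rewrite riesz_le_subl -[X in X <=E _]addr0 riesz_leD// riesz_le_refl.
rewrite -lerBrDr; apply: disjoint_sup_le => // z1 [z10 z1x z1B].
rewrite lerBrDr -lerBrDl; apply: disjoint_sup_le => // z2 [z20 z2y z2B].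
rewrite lerBrDl -linearD disjoint_sup_ub//; split=> [||w Bw].
- exact: riesz_addr_ge0.
- exact: riesz_leD.
- by apply: riesz_meetD_eq0 => //; [exact: B0|exact: z1B|exact: z2B].
Qed.

Lemma disjoint_supZ (a : R) y : 0 < a -> 0 <=E y -> p (a *: y) = a * p y.
Proof.
have scale b u : 0 < b -> 0 <=E u -> b * p u <= p (b *: u).
  move=> b0 u0; rewrite mulrC -ler_pdivlMr//.
  apply: disjoint_sup_le => // z [z0 zu zB].
  rewrite ler_pdivlMr// mulrC -[b * f z]/(b *: (f z : R^o)) -linearZ.
  have b0' := ltW b0.
  apply: disjoint_sup_ub; split=> [||w Bw].
  - exact: riesz_scale_ge0.
  - exact: riesz_le_scale.
  - by apply: riesz_meetZ_eq0 => //; [exact: B0|exact: zB].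
(* the other inequality is [scale] for the factor a^-1 and the vector a y *)
move=> a0 y0; apply/eqP; rewrite eq_le scale// andbT.
have := scale a^-1 (a *: y).
rewrite scalerA mulVf ?gt_eqF// scale1r mulrC ler_pdivrMr// mulrC.
by apply; rewrite ?invr_gt0// riesz_scale_ge0// ltW.
Qed.

(** The linear extension of [disjoint_sup f B] from the positive cone to E. *)
Definition disjoint_ext x : R^o := p (pos_part x) - p (pos_part (- x)).

Lemma disjoint_extB x y : 0 <=E x -> 0 <=E y -> disjoint_ext (x - y) = p x - p y.
Proof.
move=> x0 y0; apply/eqP; rewrite /disjoint_ext subr_eq addrAC eq_sym subr_eq.
rewrite -!disjoint_supD ?pos_part_ge0//; apply/eqP; congr (p _).
rewrite -[pos_part (x - y) in RHS](subrK (pos_part (- (x - y)))) pos_partB.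
by rewrite addrAC subrK.
Qed.

Lemma disjoint_extD x y : disjoint_ext (x + y) = disjoint_ext x + disjoint_ext y.
Proof.
rewrite -{1}(pos_partB x) -{1}(pos_partB y) addrACA -opprD.
rewrite disjoint_extB ?riesz_addr_ge0 ?pos_part_ge0//.
by rewrite !disjoint_supD ?pos_part_ge0// opprD addrACA.
Qed.

Lemma disjoint_extN x : disjoint_ext (- x) = - disjoint_ext x.
Proof. by rewrite /disjoint_ext opprK opprB. Qed.

Lemma disjoint_extZ (a : R) x : disjoint_ext (a *: x) = a *: disjoint_ext x.
Proof.
have pos b : 0 < b -> disjoint_ext (b *: x) = b *: disjoint_ext x.
  move=> b0; rewrite /disjoint_ext -scalerN !pos_partZ ?ltW//.
  by rewrite !disjoint_supZ ?pos_part_ge0// -mulrBr.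
have [a0|/pos//|->] := ltgtP a 0; last first.
  by rewrite !scale0r -(subrr (0 : E)) disjoint_extB ?riesz_le_refl// subrr.
by rewrite -[a]opprK scaleNr disjoint_extN pos ?oppr_gt0// [RHS]scaleNr.
Qed.

Lemma disjoint_ext_linear : linear disjoint_ext.
Proof. by move=> a x y; rewrite disjoint_extD disjoint_extZ. Qed.

Lemma disjoint_ext_bound x : `|disjoint_ext x| <= M * `|x|.
Proof.
have bound u : p (pos_part u) <= M * `|u|.
  apply: le_trans (disjoint_sup_bound _ (pos_part_ge0 u)) _.
  by rewrite ler_wpM2l// norm_pos_part.
have ge0 u := disjoint_sup_ge0 _ (pos_part_ge0 u).
have := bound x; have := bound (- x); rewrite normrN => bN b.
rewrite ler_norml; apply/andP; split.
  by rewrite lerNl opprB (le_trans _ bN)// lerBlDr lerDl ge0.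
by rewrite (le_trans _ b)// lerBlDr lerDl ge0.
Qed.

End Construction.

Lemma continuous_linear_bound (f : {linear E -> R^o}) : continuous f ->
  exists2 M : R, 0 <= M & forall x, `|f x| <= M * `|x|.
Proof.
move=> /linear_bounded_continuous/linear_boundedP fb.
near (+oo : set_system R)%R => M.
exists M; first by near: M; exact: nbhs_pinfty_ge.
by near: M.
Unshelve. all: by end_near. Qed.

Lemma disjoint_ext_continuous (f : {linear E -> R^o}) B : continuous f ->
  (forall w, B w -> 0 <=E w) ->
  exists2 g : {linear E -> R^o}, continuous g & g =1 disjoint_ext f B.
Proof.
move=> /continuous_linear_bound[M M0 fM] B0.
pose g : {linear E -> R^o} :=
  HB.pack (disjoint_ext f B)
    (GRing.isLinear.Build _ _ _ _ _ (disjoint_ext_linear f B M M0 fM B0)).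
exists g => //; apply/linear_bounded_continuous/linear_boundedP.
near=> r => x; apply: le_trans (disjoint_ext_bound f B M M0 fM B0 x) _.
by rewrite ler_wpM2r//; near: r; exact: nbhs_pinfty_ge.
Unshelve. all: by end_near. Qed.

End DisjointComplement.

(** * Moduli of disjoint weakly null sequences *)

Section WeaklyNull.
Context {R : realType} {E : banachLatticeType R}.
Implicit Types x : nat -> E.

Lemma disjoint_seq_pos_part x : disjoint_seq x ->
  forall n m, riesz_meet (pos_part (x n)) (pos_part (- x m)) = 0.
Proof.
move=> dx n m; have [->|/eqP nm] := eqVneq n m; first exact: pos_part_disjoint.
apply: riesz_meet_eq0_mono (dx _ _ nm); rewrite ?pos_part_ge0//.
  exact: pos_part_le_modulus.
by rewrite -modulusN pos_part_le_modulus.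
Qed.

Lemma weakly_nullN x : weakly_null x -> weakly_null (fun n => - x n).
Proof.
move=> wx f cf; under eq_fun do rewrite linearN.
by have := cvgN (wx f cf); rewrite oppr0; apply.
Qed.

Lemma disjoint_seqN x : disjoint_seq x -> disjoint_seq (fun n => - x n).
Proof. by move=> dx n m nm; rewrite !modulusN dx. Qed.

(** With B the set of all negative parts of the sequence, the functional
    [disjoint_ext f B] vanishes at every negative part and dominates f at every
    positive part, hence its value at the n-th term dominates that of f at the
    positive part of that term. *)
Lemma pos_part_dominated x (f : {linear E -> R^o}) :
  disjoint_seq x -> weakly_null x -> continuous f ->
  exists2 e : nat -> R, e @ \oo --> (0 : R) & forall n, f (pos_part (x n)) <= e n.
Proof.
move=> dx wx cf; pose B := range (fun n => pos_part (- x n)).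
have B0 w : B w -> 0 <=E w by move=> [n _ <-]; exact: pos_part_ge0.
have [M M0 fM] := continuous_linear_bound f cf.
have [g cg gE] := disjoint_ext_continuous f B cf B0.
exists (fun n => g (x n)); first exact: wx.
move=> n; rewrite gE /disjoint_ext.
have -> : disjoint_sup f B (pos_part (- x n)) = 0.
  apply/eqP; rewrite eq_le (disjoint_sup_ge0 _ _ _ M0 fM B0) ?pos_part_ge0// andbT.
  apply: (disjoint_sup_le _ _ B0); first exact: pos_part_ge0.
  move=> z [z0 zn zB]; suff -> : z = 0 by rewrite linear0.
  have : z <=E 0.
    apply: (riesz_meet_eq0_le _ _ _ (zB _ (ex_intro2 _ _ n I erefl))) => //.
    exact: riesz_le_refl.
  by move=> zle; apply: riesz_le_anti; rewrite zle z0.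
rewrite subr0; apply: (disjoint_sup_ub _ _ _ M0 fM).
split; [exact: pos_part_ge0|exact: riesz_le_refl|move=> _ [m _ <-]].
exact: disjoint_seq_pos_part.
Qed.

Lemma disjoint_weakly_null_pos_part x :
  disjoint_seq x -> weakly_null x -> weakly_null (fun n => pos_part (x n)).
Proof.
move=> dx wx f cf.
have [e1 e10 fe1] := pos_part_dominated x f dx wx cf.
pose nf : {linear E -> R^o} := \- f.
have cnf : continuous nf by move=> z; apply: cvgN; exact: cf.
have [e2 e20 fe2] := pos_part_dominated x nf dx wx cnf.
apply: (@squeeze_cvgr _ _ _ R (fun n => - e2 n) e1) => //.
  by near=> n; rewrite fe1 andbT lerNl fe2.
by have := cvgN e20; rewrite oppr0; apply.
Unshelve. all: by end_near. Qed.

Lemma disjoint_weakly_null_modulus x :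
  disjoint_seq x -> weakly_null x -> weakly_null (fun n => modulus (x n)).
Proof.
move=> dx wx f cf; under eq_fun do rewrite modulusE linearD.
have wp := disjoint_weakly_null_pos_part x dx wx f cf.
have wn := disjoint_weakly_null_pos_part _ (disjoint_seqN x dx)
  (weakly_nullN x wx) f cf.
by have := cvgD wp wn; rewrite addr0; apply.
Qed.

End WeaklyNull.

(** * Cesàro means of disjoint positive sequences *)

Section Cesaro.
Context {R : realType} {E : banachLatticeType R}.
Implicit Types x y : nat -> E.

(** The mean of index n has n + 1 terms, and that of index 2n + 1 has twice as
    many: their difference is a multiple of u - v, where u and v are the sums of
    the first and of the last n + 1 terms, and u is the positive part of u - v
    because u and v are disjoint. *)
Lemma norm_cesaro_le y n :
  (forall k, 0 <=E y k) -> (forall k l, k <> l -> riesz_meet (y k) (y l) = 0) ->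
  `|cesaro_seq y n| <= 2 * `|cesaro_seq y n - cesaro_seq y n.*2.+1|.
Proof.
move=> y0 dy; rewrite /cesaro_seq !seriesEnat /=.
set u := \sum_(0 <= k < n.+1) y k.
set v := \sum_(n.+1 <= k < n.+1.*2) y k.
have u0 : 0 <=E u by exact: riesz_sum_ge0.
have v0 : 0 <=E v by exact: riesz_sum_ge0.
have uv : riesz_meet u v = 0.
  apply: riesz_meet_sum_eq0 => // k /andP[_ kn].
  rewrite riesz_meetC; apply: riesz_meet_sum_eq0 => // l /andP[nl _].
  by apply: dy => lk; move: nl; rewrite lk leqNgt kn.
have -> : \sum_(0 <= k < n.*2.+2) y k = u + v.
  by rewrite -doubleS (@big_cat_nat _ _ _ n.+1)// -addnn leq_addr.
have -> : n.+1%:R^-1 *: u - n.*2.+2%:R^-1 *: (u + v) =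
    n.*2.+2%:R^-1 *: (u - v).
  have -> : n.+1%:R^-1 = 2 * n.*2.+2%:R^-1 :> R.
    by rewrite -doubleS -muln2 natrM; field; rewrite nat1r !pnatr_eq0.
  rewrite mulrC -scalerA -scalerBr; congr (_ *: _).
  by rewrite scaler_nat mulr2n opprD addrACA subrr add0r.
have uuv : `|u| <= `|u - v|.
  rewrite -(subr0 u) -{1}uv -pos_part_subE subr0; exact: norm_pos_part.
rewrite !normrZ mulrA !normfV !normr_nat -doubleS -muln2 natrM.
rewrite invfM mulrCA mulfV ?pnatr_eq0// mulr1.
by rewrite ler_wpM2l// invr_ge0.
Qed.

Lemma cesaro_disjoint_cvg0 y :
  (forall k, 0 <=E y k) -> (forall k l, k <> l -> riesz_meet (y k) (y l) = 0) ->
  cvgn (cesaro_seq y) -> cesaro_seq y @ \oo --> (0 : E).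
Proof.
move=> y0 dy /cvg_ex[l yl].
have y2l : cesaro_seq y n.*2.+1 @[n --> \oo] --> l.
  apply: (cvg_comp _ _ _ yl); apply/cvgnyPge => N; near=> n.
  by rewrite (@leq_trans n)//; [near: n; exact: nbhs_infty_ge|
    rewrite -addnn ltnW// ltnS leq_addr].
apply/norm_cvg0P.
apply: (@squeeze_cvgr _ _ _ R (fun=> 0)
  (fun n => 2 * `|cesaro_seq y n - cesaro_seq y n.*2.+1|)).
- by near=> n; rewrite normr_ge0 norm_cesaro_le.
- exact: cvg_cst.
- have := cvgMl_tmp (a := 2 : R) (cvg_norm (cvgB yl y2l)).
  by rewrite subrr normr0 mulr0; apply.
Unshelve. all: by end_near. Qed.

Lemma norm_cesaro_modulus x n :
  `|cesaro_seq x n| <= `|cesaro_seq (fun k => modulus (x k)) n|.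
Proof.
have n0 : 0 <= n.+1%:R^-1 :> R by rewrite invr_ge0.
apply: ler_norm_modulus; rewrite /cesaro_seq !seriesEnat !modulusZ//.
apply: riesz_le_scale => //; rewrite [X in _ <=E X]modulus_id.
  exact: modulus_sum_le.
by apply: riesz_sum_ge0 => k; exact: modulus_ge0.
Qed.

End Cesaro.

Theorem corollary3p3 (R : realType) (E : banachLatticeType R) :
  disjoint_weak_Banach_Saks E <->
  (forall x : nat -> E,
     (forall n : nat, riesz_le 0 (x n)) -> disjoint_seq x -> weakly_null x ->
     has_cesaro_cvg_subseq x).
Proof.
split=> [BS x _|BSpos x dx wx]; first exact: BS.
have modx0 n : 0 <=E modulus (x n) by exact: modulus_ge0.
have dmod k l : k <> l -> riesz_meet (modulus (x k)) (modulus (x l)) = 0.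
  exact: dx.
have [||phi phi_incr cphi] := BSpos (fun n => modulus (x n)) modx0.
- by move=> n m nm; rewrite !(modulus_id (modulus _))// dx.
- exact: disjoint_weakly_null_modulus.
exists phi => //; apply/cvg_ex; exists 0; apply/norm_cvg0P.
have mod0 : cesaro_seq ((fun n => modulus (x n)) \o phi) @ \oo --> (0 : E).
  apply: cesaro_disjoint_cvg0 => //= k l kl; apply: dmod.
  by move=> /(increasing_seq_injective phi_incr).
apply: (@squeeze_cvgr _ _ _ R (fun=> 0)
  (fun n => `|cesaro_seq ((fun n => modulus (x n)) \o phi) n|)).
- by near=> n; rewrite normr_ge0 norm_cesaro_modulus.
- exact: cvg_cst.
- by apply/norm_cvg0P.
Unshelve. all: by end_near. Qed.
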